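(* Each degenerate circle of $\mathcal A_K(L)$ is an affine Baer subplane of $\mathcal A_K(L)$ with the centre $Z$ of $L$ as underlying field.
   Context: $L$ is a quaternion skew field (a non-commutative division ring of dimension 4 over its centre) with centre $Z$, and $K$ is a maximal commutative subfield of $L$; so $[K:Z]=2$. The points of the chain geometry $\Sigma(K,L)$ are the one-dimensional right $L$-subspaces $(l_0,l_1)L$ of $L^2$, $(0,0)\ne(l_0,l_1)\in L^2$. Its blocks, called chains, are the $K$-sublines of the projective line over $L$, i.e. the sets $\{(\mathbf p k_0+\mathbf q k_1)L\mid (0,0)\neq(k_0,k_1)\in K^2\}$ where $\mathbf p,\mathbf q\in L^2$ are linearly independent over $L$ (as elements of the right $L$-vector space $L^2$). Put $\infty:=(0,1)L$. $\mathcal A_K(L)$ is the affine plane over $K$ on the 2-dimensional right $K$-vector space $L$: its points are the elements of $L$, its lines are the sets $lK+m$ with $l,m\in L$, $l\neq0$. The bijection $\rho$ from the set of points of $\Sigma(K,L)$ other than $\infty$ onto $L$ is given by $(l_0,l_1)L\mapsto l_1l_0^{-1}$. If $\mathcal C$ is a chain such that $(\mathcal C\setminus\{\infty\})^\rho$ is not a line of $\mathcal A_K(L)$, then $(\mathcal C\setminus\{\infty\})^\rho$ is called a circle; it is called degenerate if $\infty\in\mathcal C$ and non-degenerate otherwise. An affine Baer subplane of $\mathcal A_K(L)$ with underlying field $Z$ is a subset of the form $\{w+u'\xi+v'\eta\mid\xi,\eta\in Z\}$ with $w,u',v'\in L$ and $u',v'$ linearly independent over $K$ in the right $K$-vector space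 $L$. *)

(* Defs.v *)
From HB Require Import structures.
From mathcomp Require Export all_boot all_order all_algebra all_field.
From mathcomp Require Export boolp classical_sets.

Set Implicit Arguments.
Unset Strict Implicit.
Unset Printing Implicit Defensive.

Import GRing.Theory.
Local Open Scope classical_set_scope.
Local Open Scope ring_scope.

(* The centre is the field of scalars Z, i.e. the line 1%VS = {z%:A | z : Z}. *)
Definition quaternion_skew_field (Z : fieldType) (L : falgType Z) : Prop :=
  [/\ forall x : L, x != 0 -> x \is a GRing.unit,
      exists x y : L, x * y != y * x,
      'Z({:L})%VS = 1%VS
    & \dim {:L} = 4%N].

Section Subfields.
Variable L : unitRingType.

Definition commutative_subfield (K : set L) : Prop :=
  GRing.divring_closed [in K] /\ {in K &, commutative *%R}.

(* Maximality is among all commutative subfields; in particular, K is not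
   assumed to contain the centre of L. *)
Definition maximal_commutative_subfield (K : set L) : Prop :=
  commutative_subfield K /\
  forall F : set L, commutative_subfield F -> K `<=` F -> F `<=` K.

End Subfields.

Section ChainGeometry.
Variable L : unitRingType.
Implicit Types (p q : L * L) (K S : set L) (C : set (set (L * L))).

(* L ^ 2 as a right L-vector space, whereas lmodType structures are left
   modules. *)
Definition rscale p (l : L) : L * L := (p.1 * l, p.2 * l).

Definition rspan p : set (L * L) := range (rscale p).

Definition rindep p q : Prop :=
  forall a b : L, rscale p a + rscale q b = 0 -> a = 0 /\ b = 0.

Definition pt_infty : set (L * L) := rspan (0, 1).

Definition Kchain K p q : set (set (L * L)) :=
  [set rspan (rscale p k.1 + rscale q k.2) |
    k in [set k : L * L | [/\ K k.1, K k.2 & k != 0]]].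

Definition is_chain K C : Prop := exists p q, rindep p q /\ C = Kchain K p q.

(* xget picks an arbitrary representative (l0, l1) of the point P; the value
   does not depend on it, see rho_rspan. *)
Definition rho (P : set (L * L)) : L :=
  let p := xget 0 [set p | p != 0 /\ P = rspan p] in p.2 / p.1.

Lemma rho_rspan p : (forall x : L, x != 0 -> x \is a GRing.unit) ->
  p.1 != 0 -> rho (rspan p) = p.2 / p.1.
Proof.
move=> divL p1n0; have pn0 : p != 0 by apply: contraNneq p1n0 => ->.
rewrite /rho; case: xgetP => [q _ [qn0 eqpq] | /(_ p)[]//].
have [a _ Ea] : rspan p q.
  by rewrite eqpq; exists 1; rewrite // /rscale !mulr1; case: (q).
have aU : a \is a GRing.unit.
  by apply: divL; apply: contraNneq qn0 => a0; rewrite -Ea a0 /rscale !mulr0.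
have p1U := divL _ p1n0.
by rewrite -Ea [in LHS]/= invrM // mulrA mulrK.
Qed.

Definition affine_part C : set L := rho @` (C `\ pt_infty).

Definition is_line K S : Prop :=
  exists l m : L, l != 0 /\ S = [set l * k + m | k in K].

Definition degenerate_circle K S : Prop :=
  exists C, [/\ is_chain K C, S = affine_part C, ~ is_line K S & C pt_infty].

Definition Kindep K (u v : L) : Prop :=
  forall a b : L, K a -> K b -> u * a + v * b = 0 -> a = 0 /\ b = 0.

End ChainGeometry.

Definition affine_Baer_subplane (Z : fieldType) (L : falgType Z) (K S : set L)
    : Prop :=
  exists w u v : L, Kindep K u v /\
    S = [set w + u * xi%:A + v * eta%:A | xi in [set: Z] & eta in [set: Z]].

(* Main.v *)
Require Import Defs.

Set Implicit Arguments.
Unset Strict Implicit.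
Unset Printing Implicit Defensive.

Import GRing.Theory.
Local Open Scope classical_set_scope.
Local Open Scope ring_scope.

(** A chain through the point at infinity is spanned over K by some p and some
    r = (0, d), because a K-shear of the basis does not change the chain
    ([Kchain_shear]). Writing p = (a, b), its affine part is
    w + d K a^-1, with w = b a^-1 ([affine_part_chain]).

    In a quaternion skew field the centraliser of a non-central element i is
    Z + Z i: its dimension over Z is at least 2, divides 4, and is not 4
    ([cent1_quaternion]). As this centraliser is commutative, a maximal
    commutative subfield K containing i is equal to it
    ([maximal_subfield_cent1]); such an i exists in every K
    ([maximal_subfield_noncentral]). Hence, with u = d a^-1 and j = a i a^-1,
    the affine part is
      w + d (Z + Z i) a^-1 = w + u (Z + Z j) = w + u Z + u j Z.
    If j were in K, then K = Z + Z j too, and the affine part would be the line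
    w + u K; so for a degenerate circle j is not in K, which says precisely
    that u and u j are linearly independent over K. *)

(** * Commutative subfields *)

Section SubfieldClosure.
Variables (L : unitRingType) (K : set L).
Hypothesis hK : commutative_subfield K.

Lemma subfield1 : K 1.
Proof. by case: hK => -[] /asboolP. Qed.

Lemma subfieldB x y : K x -> K y -> K (x - y).
Proof.
case: hK => -[_ KB _] _ Kx Ky.
by apply/asboolP/KB; apply/asboolP.
Qed.

Lemma subfield_div x y : K x -> K y -> K (x / y).
Proof.
case: hK => -[_ _ KV] _ Kx Ky.
by apply/asboolP/KV; apply/asboolP.
Qed.

Lemma subfieldC x y : K x -> K y -> x * y = y * x.
Proof. by case: hK => _ KC Kx Ky; apply: KC; apply/asboolP. Qed.

Lemma subfield0 : K 0.
Proof. by rewrite -(subrr 1); apply: subfieldB; exact: subfield1. Qed.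

Lemma subfieldN x : K x -> K (- x).
Proof. by rewrite -sub0r; apply: subfieldB; exact: subfield0. Qed.

Lemma subfieldD x y : K x -> K y -> K (x + y).
Proof. by move=> Kx /subfieldN Ky; rewrite -[y]opprK; apply: subfieldB. Qed.

Lemma subfieldV x : K x -> K x^-1.
Proof. by rewrite -div1r; apply: subfield_div; exact: subfield1. Qed.

Lemma subfieldM x y : K x -> K y -> K (x * y).
Proof. by move=> Kx /subfieldV Ky; rewrite -[y]invrK; apply: subfield_div. Qed.

End SubfieldClosure.

(** * Maximal commutative subfields of a quaternion skew field *)

Section MaximalSubfields.
Variables (Z : fieldType) (L : falgType Z).
Hypothesis hL : quaternion_skew_field L.

(** The dimension of the centraliser is a divisor of 4, since it is a skew
    field over which the whole algebra is a vector space. *)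
Lemma cent1_quaternion (i : L) : i \notin 1%VS ->
  'C[i]%VS = (1 + <[i]>)%VS.
Proof.
case: hL => divL _ ZL dimL iZ.
have dim1i : \dim (1 + <[i]>)%VS = 2%N.
  rewrite dimv_disjoint_sum ?dimv1 ?dim_vline.
    by case: eqP iZ => // ->; rewrite mem0v.
  apply/eqP; rewrite -subv0; apply/subvP => x /memv_capP[x1 /vlineP[c Dx]].
  move: x1; rewrite memv0 Dx rpredZeq (negbTE iZ) orbF => /eqP->.
  by rewrite scale0r.
have sub1i : (1 + <[i]> <= 'C[i])%VS.
  by rewrite subv_add -!memvE cent1v1 cent1v_id.
apply/esym/eqP; rewrite eqEdim sub1i dim1i.
have dvdC : (\dim 'C[i]%VS %| 4)%N.
  by rewrite -dimL (@skew_field_dimS _ _ divL 'C[i]%AS {:L}%AS) ?subvf.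
have leC : (\dim 'C[i]%VS <= 4)%N by apply: dvdn_leq.
have neqC : \dim 'C[i]%VS != 4%N.
  apply: contraNneq iZ => dimC.
  have CL : 'C[i]%VS = fullv by apply/eqP; rewrite eqEdim subvf dimL dimC.
  rewrite -ZL memv_cap memvf /= -subv_cent1 CL; exact: subvv.
by case: (\dim _) dvdC leC neqC => [|[|[|[|[|]]]]].
Qed.

Lemma cent1_quaternionP (i : L) : i \notin 1%VS ->
  forall x : L, x * i = i * x -> exists xi eta : Z, x = xi%:A + eta *: i.
Proof.
move=> iZ x /cent1vP; rewrite cent1_quaternion //.
by case/memv_addP => _ /vlineP[xi ->] [_ /vlineP[eta ->] ->]; exists xi, eta.
Qed.

Lemma cent1_commutative_subfield (i : L) : i \notin 1%VS ->
  commutative_subfield [set x : L | x * i = i * x].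
Proof.
move=> iZ; case: (hL) => divL _ _ _; split; first split.
- by apply/asboolP; rewrite /= mul1r mulr1.
- move=> x y /asboolP /= xi /asboolP /= yi; apply/asboolP => /=.
  by rewrite mulrBl mulrBr xi yi.
- move=> x y /asboolP /= xi /asboolP /= yi; apply/asboolP => /=.
  by rewrite -mulrA -(commrV (esym yi : GRing.comm i y)) !mulrA xi.
move=> x y /asboolP /= xi /asboolP /= yi.
case: (cent1_quaternionP iZ xi) => a [b ->].
rewrite mulrDl mulrDr -!scalerAl -!scalerAr mul1r mulr1.
by rewrite yi.
Qed.

(** K is the centraliser Z + Z i of i: it lies in that centraliser, which is itself a
    commutative subfield. That K contains the centre is a consequence, not an
    assumption. *)
Lemma maximal_subfield_cent1 (K : set L) (i : L) :
  maximal_commutative_subfield K -> i \notin 1%VS -> K i ->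
  forall x, K x <-> exists xi eta : Z, x = xi%:A + eta *: i.
Proof.
move=> [hK maxK] iZ Ki x; split=> [Kx | [xi [eta ->]]].
  by apply: cent1_quaternionP => //; exact: subfieldC hK _ _ Kx Ki.
apply: (maxK _ (cent1_commutative_subfield iZ)) => [y Ky /= | /=].
  exact: subfieldC hK _ _ Ky Ki.
by rewrite mulrDl mulrDr -!scalerAl -!scalerAr mul1r mulr1.
Qed.

(** If K were central, it would lie in the centraliser of every non-central x,
    hence contain x by maximality. *)
Lemma maximal_subfield_noncentral (K : set L) :
  maximal_commutative_subfield K -> exists2 i, K i & i \notin 1%VS.
Proof.
move=> [hK maxK]; apply: contrapT => noi.
have KZ x : K x -> x \in 1%VS.
  by move=> Kx; apply: contrapT => /negP xZ; apply: noi; exists x.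
case: hL => _ [x [y xy]] _ _.
have xZ : x \notin 1%VS.
  apply: contra xy => /vlineP[c ->].
  by rewrite -scalerAl -scalerAr mul1r mulr1.
apply/noi; exists x => //.
apply: (maxK _ (cent1_commutative_subfield xZ)) => //= z /KZ /vlineP[c ->].
by rewrite /= -scalerAl -scalerAr mul1r mulr1.
Qed.

End MaximalSubfields.

(** * Chains through the point at infinity *)

Section ChainsThroughInfinity.
Variable L : unitRingType.
Hypothesis divL : forall x : L, x != 0 -> x \is a GRing.unit.
Variable K : set L.
Hypothesis hK : commutative_subfield K.
Implicit Types p q : L * L.

Lemma rscaleDr p (a b : L) : rscale p (a + b) = rscale p a + rscale p b.
Proof. by rewrite /rscale !mulrDr. Qed.

Lemma rscaleDl p q (a : L) : rscale (p + q) a = rscale p a + rscale q a.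
Proof. by rewrite /rscale !mulrDl. Qed.

Lemma rscaleA p (a b : L) : rscale (rscale p a) b = rscale p (a * b).
Proof. by rewrite /rscale /= !mulrA. Qed.

Lemma rscale0r p : rscale p 0 = 0.
Proof. by rewrite /rscale !mulr0. Qed.

Lemma rscale1 p : rscale p 1 = p.
Proof. by rewrite /rscale !mulr1; case: p. Qed.

Lemma rspan_rscale p (a : L) : a != 0 -> rspan (rscale p a) = rspan p.
Proof.
move=> /divL aU; rewrite eqEsubset; split=> _ [b _ <-].
  by rewrite rscaleA; exists (a * b).
by exists (a^-1 * b) => //; rewrite rscaleA mulVKr.
Qed.

Lemma rindepC p q : rindep p q -> rindep q p.
Proof. by move=> pq a b; rewrite addrC => /pq[]. Qed.

Lemma KchainC p q : Kchain K p q = Kchain K q p.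
Proof.
suff sub p1 q1 : Kchain K p1 q1 `<=` Kchain K q1 p1 by rewrite eqEsubset.
move=> _ [k [Kk1 Kk2 k0] <-]; exists (k.2, k.1); last by rewrite addrC.
split=> //; apply: contraNneq k0.
by case: k {Kk1 Kk2} => k1 k2 /= [-> ->].
Qed.

(** A change of basis with matrix in GL(2, K) that fixes the first basis
    vector does not change the chain. *)
Lemma Kchain_shear p q (k l : L) : K k -> K l -> l != 0 ->
  Kchain K p (rscale p k + rscale q l) = Kchain K p q.
Proof.
(* One inclusion suffices: q is obtained from p and the new second vector by
   a transformation of the same kind. *)
have sub p1 q1 (a b : L) : K a -> K b -> b != 0 ->
    Kchain K p1 (rscale p1 a + rscale q1 b) `<=` Kchain K p1 q1.
  move=> Ka Kb b0 _ [[x y] /= [Kx Ky xy0] <-].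
  exists (x + a * y, b * y) => /=; last first.
    by rewrite rscaleDl rscaleDr !rscaleA addrA.
  split=> /=; [exact: subfieldD (subfieldM _ _ _)|exact: subfieldM|].
  apply: contraNneq xy0 => -[xay0 /(canRL (mulKr (divL b0)))].
  by rewrite mulr0 => y0; move: xay0; rewrite y0 mulr0 addr0 => ->.
move=> Kk Kl l0; rewrite eqEsubset; split; first exact: sub.
have KlV : K l^-1 by exact: subfieldV.
have lU := divL l0.
have qE : q = rscale p (- (k * l^-1)) +
    rscale (rscale p k + rscale q l) l^-1.
  rewrite rscaleDl !rscaleA divrr // rscale1 addrA -rscaleDr addNr.
  by rewrite rscale0r add0r.
rewrite [X in Kchain K p X `<=` _]qE; apply: sub => //; last exact: invr_neq0.
by apply: subfieldN => //; exact: subfieldM.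
Qed.

Lemma rspan_infty (d : L) : d != 0 -> rspan (0, d) = @pt_infty L.
Proof.
move=> d0; rewrite /pt_infty -(rspan_rscale (0, 1) d0).
by rewrite /rscale /= mul0r mul1r.
Qed.

Lemma affine_part_Kchain p (d : L) : p.1 != 0 -> d != 0 ->
  affine_part (Kchain K p (0, d)) = [set p.2 / p.1 + d * k / p.1 | k in K].
Proof.
move=> p10 d0.
have vecE (k l : L) : rscale p k + rscale (0, d) l = (p.1 * k, p.2 * k + d * l).
  by rewrite /rscale /= mul0r; congr pair; exact: addr0.
have p1U := divL p10.
rewrite eqEsubset.
split=> [_ [_ [[[k l] /= [Kk Kl kl0] <-] Pinf] <-] | _ [k Kk <-]].
  have k0 : k != 0.
    apply: contra_notN Pinf => /eqP k0; move: kl0; rewrite k0 => l0.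
    rewrite rscale0r add0r /=.
    have {}l0 : l != 0 by apply: contraNneq l0 => ->.
    by rewrite rspan_rscale // rspan_infty.
  have kU := divL k0.
  have pk0 : p.1 * k != 0 by rewrite -(mul0r k) (can_eq (mulrK kU)).
  exists (l / k); first exact: subfield_div.
  by rewrite vecE rho_rspan //= invrM // mulrDl !mulrA mulrK.
exists (rspan (rscale p 1 + rscale (0, d) k)).
  split.
    exists (1, k) => //=; split=> //=; first exact: subfield1.
    by apply/eqP => -[/eqP]; rewrite oner_eq0.
  rewrite /= vecE !mulr1 => eqinf.
  have : @pt_infty L (p.1, p.2 + d * k).
    by rewrite -eqinf -[X in _ X]rscale1; exists 1.
  by case=> a _ [p1E _]; move: p10; rewrite -p1E mul0r eqxx.
by rewrite vecE !mulr1 rho_rspan //= mulrDl.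
Qed.

Lemma affine_part_chain C : is_chain K C -> C (@pt_infty L) ->
  exists w a d : L, [/\ a != 0, d != 0 &
    affine_part C = [set w + d * k / a | k in K]].
Proof.
move=> [p [q [pq ->]]] Cinf.
(* The two basis vectors are exchanged, if need be, so that the second one has
   a nonzero coefficient in a vector spanning the point at infinity. *)
have [p' [q' [k [l [Kk Kl l0 pq' [-> einf]]]]]] : exists p' q' (k l : L),
  [/\ K k, K l, l != 0, rindep p' q' & Kchain K p q = Kchain K p' q' /\
     rspan (rscale p' k + rscale q' l) = @pt_infty L].
  case: Cinf => -[k l] /= [Kk Kl kl0] einf.
  have [l0|l0] := eqVneq l 0; last by exists p, q, k, l.
  exists q, p, l, k; split=> //; last 2 first.
  - exact: rindepC.
  - by rewrite KchainC addrC.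
  by apply: contraNneq kl0 => ->; rewrite l0.
have lU := divL l0.
rewrite -(Kchain_shear p' q' Kk Kl l0).
set r := rscale p' k + rscale q' l in einf *.
have [d _ rE] : @pt_infty L r by rewrite -einf -{2}[r]rscale1; exists 1.
have {}rE : r = (0, d) by rewrite -rE /rscale /= mul0r mul1r.
have pr : rindep p' r.
  move=> a b; rewrite /r rscaleDl !rscaleA addrA -rscaleDr.
  move/pq' => [E /(canRL (mulKr lU))].
  by rewrite mulr0 => b0; move: E; rewrite b0 mulr0 addr0.
have d0 : d != 0.
  apply/eqP => d0; have [_ /eqP] : (0 : L) = 0 /\ (1 : L) = 0.
    apply: pr; rewrite rE d0 /rscale /= !mulr0 !mul0r.
    by congr pair; exact: addr0.
  by rewrite oner_eq0.
have p0 : p'.1 != 0.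
  apply/eqP => p0; have [/eqP] : (1 : L) = 0 /\ - (d^-1 * p'.2) = 0.
    apply: pr; rewrite rE /rscale /= !mulr1 mul0r p0 mulrN mulVKr ?divL //.
    by congr pair; [exact: addr0|exact: subrr].
  by rewrite oner_eq0.
by exists (p'.2 / p'.1), p'.1, d; rewrite rE affine_part_Kchain.
Qed.

End ChainsThroughInfinity.

Theorem theorem2 (Z : fieldType) (L : falgType Z)
    (hL : quaternion_skew_field L)
    (K : set L) (hK : maximal_commutative_subfield K)
    (S : set L) (hS : degenerate_circle K S) :
  affine_Baer_subplane K S.
Proof.
case: (hL) => divL _ _ _; have [hsub _] := hK.
have [i Ki iZ] := maximal_subfield_noncentral hL hK.
have KE := maximal_subfield_cent1 hL hK iZ Ki.
case: hS => C [Cchain -> notline Cinf].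
have [w [a [d [a0 d0 SE]]]] := affine_part_chain divL hsub Cchain Cinf.
have [aU dU] := (divL a a0, divL d d0).
rewrite SE in notline *.
pose j := a * i / a; pose u := d / a.
have uU : u \is a GRing.unit by rewrite unitrMl ?unitrV.
have u0 : u != 0 by apply: contraTneq uU => ->; rewrite unitr0.
have coefE (xi eta : Z) :
    d * (xi%:A + eta *: i) / a = u * (xi%:A + eta *: j).
  rewrite mulrDr mulrDl mulrDr -!scalerAr -!scalerAl !mulr1.
  by rewrite /u /j !mulrA mulrVK.
have jZ : j \notin 1%VS.
  apply: contra iZ => /vlineP[c jc]; apply/vlineP; exists c.
  have -> : i = a^-1 * j * a by rewrite /j !mulrA mulVr // mul1r mulrVK.
  by rewrite jc -scalerAr -scalerAl mulr1 mulVr.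
(* Otherwise K = Z + Z j, and the circle is the line u K + w. *)
have jK : ~ K j.
  move=> Kj; apply: notline; exists u, w; split=> //.
  have KEj := maximal_subfield_cent1 hL hK jZ Kj.
  rewrite eqEsubset; split=> _ [k Kk <-].
    have [xi [eta ->]] := (KE k).1 Kk; exists (xi%:A + eta *: j).
      by apply/KEj; exists xi, eta.
    by rewrite coefE addrC.
  have [xi [eta ->]] := (KEj k).1 Kk; exists (xi%:A + eta *: i).
    by apply/KE; exists xi, eta.
  by rewrite coefE addrC.
exists w, u, (u * j); split.
  (* u b + u j c = 0 means b + j c = 0, which puts j in K unless c = 0. *)
  move=> b c Kb Kc; rewrite -mulrA -mulrDr => /(canRL (mulKr uU)).
  rewrite mulr0 => bjc.
  have c0 : c = 0.
    apply/eqP; apply: contrapT => /negP c0; apply: jK.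
    have -> : j = - b / c.
      rewrite -(mulrK (divL _ c0) j); congr (_ / _).
      by apply/eqP; rewrite -addr_eq0 addrC bjc.
    by apply: subfield_div => //; exact: subfieldN.
  by move: bjc; rewrite c0 mulr0 addr0.
have vecE (xi eta : Z) :
    w + u * xi%:A + u * j * eta%:A = w + u * (xi%:A + eta *: j).
  by rewrite mulrDr -!scalerAr !mulr1 addrA.
rewrite eqEsubset; split=> [_ [k /KE[xi [eta ->]] <-] | _ [xi _ [eta _ <-]]].
  by exists xi => //; exists eta => //; rewrite vecE coefE.
exists (xi%:A + eta *: i); first by apply/KE; exists xi, eta.
by rewrite vecE coefE.
Qed.
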